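(* Let $(Q,I)$ be datum in the signature appropriate for multilinear $R$-module expansions (operations named by $F$). The class of varieties in this signature (subvarieties of ${}_R\mathcal M_F$) which contain the datum forms a complete lattice $\mathcal L(Q,I)$. The maps $\Psi(\mathcal U):=H^2_{\mathcal U}(Q,I)$ and $\Theta(E):=\mathcal V(\{I\rtimes_TQ:[T]\in E\})$ (the variety generated by the indicated algebras) define a Galois connection $(\Theta,\Psi)$ between the ordered sets $\mathcal H^2(Q,I)$ and $\mathcal L(Q,I)$, with $\Theta$ the lower adjoint; that is, both maps are monotone and $\Theta(E)\le\mathcal U$ if and only if $E\subseteq\Psi(\mathcal U)$ for all $E\in\mathcal H^2(Q,I)$, $\mathcal U\in\mathcal L(Q,I)$.
   Context: $R$ is a fixed ring, $F$ a set of operation symbols of finite positive arities $\mathrm{ar} f$, and ${}_R\mathcal M_F$ is the variety of all $R$-modules expanded by an $R$-multilinear operation for each $f\in F$, in the signature $\{+,-,0\}\cup R\cup F$. $Q,I\in{}_R\mathcal M_F$; a variety contains the datum if it contains $Q$ and $I$. $\mathrm{Id}\,\mathcal U$ is the set of identities of a variety $\mathcal U$. $[n]=\{1,\dots,n\}$, $[n]^\ast$ is the set of nonempty proper subsets of $[n]$; $\vec q_s[\vec p]$ is $\vec q$ with the coordinates in $s$ replaced by those of $\vec p$. A 2-cocycle $T$ for $(Q,I)$ consists of factor sets $T_+:Q^2\to I$, $T_r:Q\to I$ $(r\in R)$, $T_f:Q^{\mathrm{ar} f}\to I$ $(f\in F)$ with $T_+(x,0)=T_+(0,x)=0$, $T_r(0)=0$,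 $T_f(\vec x)=0$ if some $x_i=0$, and action terms $a(f,s):Q^n\times I^n\to I$ ($f\in F$, $n=\mathrm{ar} f$, $s\in[n]^\ast$), where $a(f,s)(\vec q,\vec a)$ depends only on $q_j$ ($j\notin s$) and $a_j$ ($j\in s$), is $R$-multilinear in the $a_j$, $j\in s$, and vanishes if $q_j=0$ for some $j\notin s$. The algebra $I\rtimes_TQ$ has universe $I\times Q$ and $\langle a,x\rangle+\langle b,y\rangle=\langle a+b+T_+(x,y),x+y\rangle$, $-\langle a,x\rangle=\langle -a-T_+(x,-x),-x\rangle$, $r\cdot\langle a,x\rangle=\langle r\cdot a+T_r(x),r\cdot x\rangle$, $F_f(\langle a_1,x_1\rangle,\dots,\langle a_n,x_n\rangle)=\langle f^I(\vec a)+\sum_{s\in[n]^\ast}a(f,s)(\vec x,\vec a)+T_f(\vec x),f^Q(\vec x)\rangle$. For a term $t$, write its interpretation in $I\rtimes_TQ$ as $\langle t^I(\vec a)+D^T_t(\vec a,\vec q),t^Q(\vec q)\rangle$; $T$ is $\mathcal U$-compatible if $D^T_t=D^T_s$ for all $t=s\in\mathrm{Id}\,\mathcal U$. 2-cocycles $T$ (action terms $a(f,s)$) and $T'$ (action terms $a'(f,s)$) are equivalent, $T\sim T'$, if there is $h:Q\to I$ with $h(0)=0$ such that, with $n=\mathrm{ar} f$: $(T-T')_+(x,y)=h(x)+h(y)-h(x+y)$; $(T-T')_r(x)=r\cdot h(x)-h(r\cdot x)$; $(T-T')_f(\vec x)=\sum_{s\in[n]^\ast}(-1)^{1+|s|}a(f,s)(\vec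 x,h(\vec x))+(-1)^{1+n}f^I(h(\vec x))-h(f^Q(\vec x))$; $(a(f,s)-a'(f,s))(\vec x,\vec a)=\sum_{s\subsetneq r\in[n]^\ast}(-1)^{1+|r|-|s|}a(f,r)(\vec x,h(\vec x)_s[\vec a])+(-1)^{1+n-|s|}f^I(h(\vec x)_s[\vec a])$. $[T]$ is the equivalence class of $T$. For $\mathcal U\le{}_R\mathcal M_F$ containing the datum, $H^2_{\mathcal U}(Q,I)$ is the set of equivalence classes of $\mathcal U$-compatible 2-cocycles, and $\mathcal H^2(Q,I)=\{H^2_{\mathcal U}(Q,I):\mathcal U\in\mathcal L(Q,I)\}$ ordered by inclusion. Varieties are ordered by inclusion. *)

(* Defs.v *)
From mathcomp Require Import all_boot all_order all_algebra.

Set Implicit Arguments.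
Unset Strict Implicit.
Unset Printing Implicit Defensive.

Import GRing.Theory.
Local Open Scope ring_scope.

(* The type [set] of mathcomp.classical is not used for classes: its universe
   is bounded by that of the carriers of modules, so it has no room for a class
   of algebras. *)
Definition class (T : Type) : Type := T -> Prop.

Definition subclass (T : Type) (C D : class T) : Prop :=
  forall x, C x -> D x.

(* The family L of classes, ordered by inclusion, is a complete lattice: every
   subfamily has a least upper bound and a greatest lower bound in L. *)
Definition complete_lattice (T : Type) (L : class (class T)) : Prop :=
  forall S : class (class T), subclass S L ->
    (exists J, [/\ L J,
       forall U, S U -> subclass U J &
       forall V, L V -> (forall U, S U -> subclass U V) -> subclass J V]) /\
    (exists M, [/\ L M,
       forall U, S U -> subclass M U &
       forall V, L V -> (forall U, S U -> subclass V U) -> subclass V M]).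

(* Coordinates are indexed by 'I_n (0-based) instead of {1, ..., n}, and the
   n-tuples over A are the functions 'I_n -> A. *)

(* [n]^*: the nonempty proper subsets of the index set. *)
Definition pset (n : nat) : finType :=
  {s : {set 'I_n} | (s != set0) && (s != [set: 'I_n])}.

(* q_s[p] *)
Definition replace (n : nat) (A : Type) (q : 'I_n -> A) (s : {set 'I_n})
    (p : 'I_n -> A) : 'I_n -> A :=
  fun j => if j \in s then p j else q j.

Definition multilinear_on (R : pzRingType) (n : nat) (s : {set 'I_n})
    (A B : lmodType R) (f : ('I_n -> A) -> B) : Prop :=
  forall (a : 'I_n -> A) (j : 'I_n), j \in s ->
    linear (fun u : A => f [eta a with j |-> u]).

(* Algebras in the signature {+, -, 0} u R u F, subject to no law. *)
Record alg (R : pzRingType) (F : Type) (ar : F -> nat) := Alg {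
  carrier : Type;
  alg_add : carrier -> carrier -> carrier;
  alg_opp : carrier -> carrier;
  alg_zero : carrier;
  alg_scale : R -> carrier -> carrier;
  alg_op : forall f : F, ('I_(ar f) -> carrier) -> carrier }.
Arguments alg_op {R F ar} a f _.

Inductive term (R : pzRingType) (F : Type) (ar : F -> nat) :=
  | Var of nat
  | TZero
  | TAdd of term R ar & term R ar
  | TOpp of term R ar
  | TScale of R & term R ar
  | TOp (f : F) of 'I_(ar f) -> term R ar.

Section UniversalAlgebra.
Variables (R : pzRingType) (F : Type) (ar : F -> nat).

Fixpoint eval (A : alg R ar) (e : nat -> carrier A) (t : term R ar)
    : carrier A :=
  match t with
  | Var i => e i
  | TZero => alg_zero A
  | TAdd t1 t2 => alg_add (eval e t1) (eval e t2)
  | TOpp t1 => alg_opp (eval e t1)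
  | TScale r t1 => alg_scale r (eval e t1)
  | TOp f ts => alg_op A f (fun i => eval e (ts i))
  end.

Definition satisfies (A : alg R ar) (t s : term R ar) : Prop :=
  forall e : nat -> carrier A, eval e t = eval e s.

(* t = s is in Id U *)
Definition Id (U : class (alg R ar)) (t s : term R ar) : Prop :=
  forall A, U A -> satisfies A t s.

Definition variety (U : class (alg R ar)) : Prop :=
  exists Sigma : term R ar -> term R ar -> Prop,
    forall A, U A <-> (forall t s, Sigma t s -> satisfies A t s).

Definition generated_variety (K : class (alg R ar)) : class (alg R ar) :=
  fun A => forall U, variety U -> subclass K U -> U A.

End UniversalAlgebra.

(* Members of the variety _R M_F. *)
Record mexp (R : pzRingType) (F : Type) (ar : F -> nat) := Mexp {
  mexp_sort :> lmodType R;
  mexp_op : forall f : F, ('I_(ar f) -> mexp_sort) -> mexp_sort;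
  mexp_opP : forall f : F, multilinear_on [set: 'I_(ar f)] (@mexp_op f) }.
Arguments mexp_op {R F ar} m f _.

Definition alg_of (R : pzRingType) (F : Type) (ar : F -> nat) (M : mexp R ar)
    : alg R ar :=
  @Alg R F ar M (fun x y => x + y) (fun x => - x) 0 (fun r x => r *: x)
    (mexp_op M).

(* The variety _R M_F as a class of algebras in the signature.  The choice
   structure carried by an lmodType restricts nothing: classically it exists
   on every type. *)
Definition RMF (R : pzRingType) (F : Type) (ar : F -> nat) : class (alg R ar) :=
  fun A => exists M : mexp R ar, A = alg_of M.

(* co_add, co_scale, co_op are the factor sets; act f s is a(f, s). *)
Record cocycle (R : pzRingType) (F : Type) (ar : F -> nat) (Q I : mexp R ar) :=
  Cocycle {
  co_add : Q -> Q -> I;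
  co_scale : R -> Q -> I;
  co_op : forall f : F, ('I_(ar f) -> Q) -> I;
  act : forall (f : F) (s : pset (ar f)),
    ('I_(ar f) -> Q) -> ('I_(ar f) -> I) -> I;
  co_addx0 : forall x, co_add x 0 = 0;
  co_add0x : forall x, co_add 0 x = 0;
  co_scale0 : forall r, co_scale r 0 = 0;
  co_op0 : forall (f : F) (x : 'I_(ar f) -> Q),
    (exists i, x i = 0) -> @co_op f x = 0;
  act_dep : forall (f : F) (s : pset (ar f)) (q q' : 'I_(ar f) -> Q)
      (a a' : 'I_(ar f) -> I),
    (forall j, j \notin val s -> q j = q' j) ->
    (forall j, j \in val s -> a j = a' j) ->
    act s q a = act s q' a';
  act_multilinear : forall (f : F) (s : pset (ar f)) (q : 'I_(ar f) -> Q),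
    multilinear_on (val s) (act s q);
  act0 : forall (f : F) (s : pset (ar f)) (q : 'I_(ar f) -> Q)
      (a : 'I_(ar f) -> I),
    (exists2 j, j \notin val s & q j = 0) -> act s q a = 0 }.
Arguments co_op {R F ar Q I} c f _.
Arguments act {R F ar Q I} c f s _ _.

Section Cohomology.
Variables (R : pzRingType) (F : Type) (ar : F -> nat) (Q I : mexp R ar).

Definition semidirect (T : cocycle Q I) : alg R ar :=
  @Alg R F ar (I * Q)%type
    (fun u v => (u.1 + v.1 + co_add T u.2 v.2, u.2 + v.2))
    (fun u => (- u.1 - co_add T u.2 (- u.2), - u.2))
    (0, 0)
    (fun r u => (r *: u.1 + co_scale T r u.2, r *: u.2))
    (fun f u =>
      let a := fun i => (u i).1 in
      let x := fun i => (u i).2 in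
      (mexp_op I f a + \sum_(s : pset (ar f)) act T f s x a + co_op T f x,
       mexp_op Q f x)).

(* D^T_t *)
Definition defect (T : cocycle Q I) (t : term R ar)
    (a : nat -> I) (q : nat -> Q) : I :=
  (eval (A := semidirect T) (fun i => (a i, q i)) t).1
    - eval (A := alg_of I) a t.

Definition compatible (U : class (alg R ar)) (T : cocycle Q I) : Prop :=
  forall t s, Id U t s -> forall a q, defect T t a q = defect T s a q.

Definition equivalent (T T' : cocycle Q I) : Prop :=
  exists2 h : Q -> I, h 0 = 0 &
  [/\ forall x y, co_add T x y - co_add T' x y = h x + h y - h (x + y),
      forall r x, co_scale T r x - co_scale T' r x = r *: h x - h (r *: x),
      forall (f : F) (x : 'I_(ar f) -> Q),
        co_op T f x - co_op T' f x =
          \sum_(s : pset (ar f))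
            (-1) ^+ (1 + #|val s|) *: act T f s x (h \o x)
          + (-1) ^+ (1 + ar f) *: mexp_op I f (h \o x)
          - h (mexp_op Q f x)
    & forall (f : F) (s : pset (ar f))
        (x : 'I_(ar f) -> Q) (a : 'I_(ar f) -> I),
        act T f s x a - act T' f s x a =
          \sum_(r : pset (ar f) | val s \proper val r)
            (-1) ^+ (1 + #|val r| - #|val s|) *:
              act T f r x (replace (h \o x) (val s) a)
          + (-1) ^+ (1 + ar f - #|val s|) *:
              mexp_op I f (replace (h \o x) (val s) a)].

(* [T] *)
Definition eqclass (T : cocycle Q I) : class (cocycle Q I) :=
  fun T' => equivalent T T'.

(* Psi *)
Definition H2 (U : class (alg R ar)) : class (class (cocycle Q I)) :=
  fun c => exists2 T, compatible U T & c = eqclass T.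

Definition Theta (E : class (class (cocycle Q I))) : class (alg R ar) :=
  generated_variety
    (fun A => exists2 T : cocycle Q I, E (eqclass T) & A = semidirect T).

(* L(Q,I) *)
Definition varieties_containing : class (class (alg R ar)) :=
  fun U => [/\ variety U, subclass U (@RMF R F ar), U (alg_of Q) &
               U (alg_of I)].

(* The set of all H^2_U(Q,I) with U in L(Q,I). *)
Definition H2s : class (class (class (cocycle Q I))) :=
  fun E => exists2 U, varieties_containing U & E = H2 U.

End Cohomology.
Arguments H2 {R F ar} Q I U _.
Arguments Theta {R F ar} Q I E _.
Arguments H2s {R F ar} Q I E.

(* Main.v *)
From HB Require Import structures.
Require Import Defs.
From mathcomp Require Import all_boot all_order all_algebra.
From mathcomp Require Import boolp.

(** A variety U containing Q and I satisfies the following key equivalence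
    ([H2_semidirect]): the class of T lies in H^2_U(Q, I) if and only if the
    extension of Q by I along T is a member of U.  For a U-compatible T this is
    [compatible_semidirect]: an identity of U holds in Q and in I, so it holds
    in the extension exactly when its two sides have the same defect.  It
    remains to see that compatibility is invariant under equivalence.  If T ~ T'
    through h, the bijection (b, x) |-> (b - h(x), x) is a homomorphism from the
    extension by T' to the one by T ([equivalent_twist_hom]).  For the
    multilinear operations this is the multilinear expansion at b - h
    ([multilinear_expand]) of f and of the action terms, compared subset by
    subset.

    The adjunction is then formal: for E = H^2_V(Q, I), both sides of it say
    that all the extensions along cocycles with class in E are members of U.  In
    particular Theta(E) is included in V, hence in _R M_F.  It contains Q and I
    because E contains the class of the zero cocycle, whose extension is the
    product of I and Q and so has both as quotients.

    The lattice is complete because the varieties containing the datum are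
    closed under arbitrary intersections taken inside _R M_F
    ([varieties_containing_inter]).  This includes the empty intersection, since
    _R M_F is itself a variety ([RMF_variety]): by choice, the carrier of any
    algebra satisfying the module and multilinearity laws can be equipped with
    the structure of a module. *)

Set Implicit Arguments.
Unset Strict Implicit.
Unset Printing Implicit Defensive.

Import GRing.Theory.
Local Open Scope ring_scope.

(** * Varieties and homomorphisms *)

Section Varieties.
Variables (R : pzRingType) (F : Type) (ar : F -> nat).
Implicit Types (A B : alg R ar) (t s : term R ar) (U V : class (alg R ar)).

(** A variety is the class of all models of its own identities. *)
Lemma varietyP U : variety U ->
  forall A, U A <-> (forall t s, Id U t s -> satisfies A t s).
Proof.
move=> [Sigma US] A; split=> [UA t s|AU]; first exact.
by apply/US => t s Sts; apply: AU => B /US; apply.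
Qed.

Lemma variety_inter (K : class (class (alg R ar))) :
  (forall U, K U -> variety U) -> variety (fun A => forall U, K U -> U A).
Proof.
move=> KV; exists (fun t s => exists2 U, K U & Id U t s) => A; split.
  by move=> AK t s [U KU]; apply; apply: AK.
by move=> AK U KU; apply/(varietyP (KV U KU)) => t s Uts; apply: AK; exists U.
Qed.

Lemma generated_variety_variety (K : class (alg R ar)) :
  variety (generated_variety K).
Proof.
have [U|Sigma SigmaP] :=
  @variety_inter (fun U => variety U /\ subclass K U); first by case.
exists Sigma => A; rewrite -SigmaP; split=> AK U.
  by move=> [vU KU]; apply: AK.
by move=> vU KU; apply: AK.
Qed.

(** Homomorphisms of algebras in the signature. *)
Definition hom A B (phi : carrier A -> carrier B) : Prop :=
  [/\ forall x y, phi (alg_add x y) = alg_add (phi x) (phi y),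
      forall x, phi (alg_opp x) = alg_opp (phi x),
      phi (alg_zero A) = alg_zero B,
      forall r x, phi (alg_scale r x) = alg_scale r (phi x)
    & forall f x, phi (alg_op A f x) = alg_op B f (phi \o x)].

Lemma hom_eval A B (phi : carrier A -> carrier B) : hom phi ->
  forall e t, phi (eval e t) = eval (phi \o e) t.
Proof.
move=> [phiD phiN phi0 phiZ phiop] e.
elim=> //= [t IHt s IHs|t IH|r t IH|f ts IH].
- by rewrite phiD IHt IHs.
- by rewrite phiN IH.
- by rewrite phiZ IH.
- by rewrite phiop; congr alg_op; apply: funext => i /=; rewrite IH.
Qed.

(** Identities pass to homomorphic images; surjectivity of phi is given by a
    section psi, which need not be a homomorphism. *)
Lemma satisfies_quotient A B (phi : carrier A -> carrier B) psi :
    hom phi -> cancel psi phi ->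
  forall t s, satisfies A t s -> satisfies B t s.
Proof.
move=> phi_hom psiK t s Ats e.
have -> : e = phi \o (psi \o e) by apply: funext => i /=; rewrite psiK.
by rewrite -!(hom_eval phi_hom) Ats.
Qed.

(** * The variety of multilinear module expansions *)

(** The identities of R-modules with multilinear operations; multilinearity of
    f in the coordinate j is the identity expressing linearity of f with
    the variables 0 and 1 in the coordinate j, each other coordinate i holding
    the variable i + 2. *)
Inductive law : term R ar -> term R ar -> Prop :=
  | LawAddA : law (TAdd (Var R ar 0) (TAdd (Var R ar 1) (Var R ar 2)))
                  (TAdd (TAdd (Var R ar 0) (Var R ar 1)) (Var R ar 2))
  | LawAddC : law (TAdd (Var R ar 0) (Var R ar 1))
                  (TAdd (Var R ar 1) (Var R ar 0))
  | LawAdd0 : law (TAdd (TZero R ar) (Var R ar 0)) (Var R ar 0)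
  | LawAddN : law (TAdd (TOpp (Var R ar 0)) (Var R ar 0)) (TZero R ar)
  | LawScaleA r r' : law (TScale r (TScale r' (Var R ar 0)))
                         (TScale (r * r') (Var R ar 0))
  | LawScale1 : law (TScale 1 (Var R ar 0)) (Var R ar 0)
  | LawScaleDr r : law (TScale r (TAdd (Var R ar 0) (Var R ar 1)))
                       (TAdd (TScale r (Var R ar 0)) (TScale r (Var R ar 1)))
  | LawScaleDl r r' : law (TScale (r + r') (Var R ar 0))
                          (TAdd (TScale r (Var R ar 0))
                                (TScale r' (Var R ar 0)))
  | LawOp f (j : 'I_(ar f)) r :
      let x u := TOp (fun i => if i == j then u else Var R ar i.+2) in
      law (x (TAdd (TScale r (Var R ar 0)) (Var R ar 1)))
          (TAdd (TScale r (x (Var R ar 0))) (x (Var R ar 1))).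

Section LawModule.
Variables (A : alg R ar) (lawA : forall t s, law t s -> satisfies A t s).

(** The carrier of an algebra satisfying the laws, as an R-module; the type
    depends on the proof of the laws so that the instances can be attached to
    it. *)
Definition law_module of (forall t s, law t s -> satisfies A t s) : Type :=
  carrier A.
Local Notation M := (law_module lawA).

HB.instance Definition _ := gen_eqMixin M.
HB.instance Definition _ := gen_choiceMixin M.

(* Valuation of the variables 0, 1, 2. *)
Let env (x y z : carrier A) (n : nat) : carrier A :=
  if n is n'.+1 then (if n' is _.+1 then z else y) else x.

Let addA : associative (@alg_add R F ar A : M -> M -> M).
Proof. by move=> x y z; apply: (lawA LawAddA (env x y z)). Qed.

Let addC : commutative (@alg_add R F ar A : M -> M -> M).
Proof. by move=> x y; apply: (lawA LawAddC (env x y x)). Qed.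

Let add0 : left_id (alg_zero A : M) (@alg_add R F ar A : M -> M -> M).
Proof. by move=> x; apply: (lawA LawAdd0 (env x x x)). Qed.

Let addN :
  left_inverse (alg_zero A : M) (@alg_opp R F ar A) (@alg_add R F ar A).
Proof. by move=> x; apply: (lawA LawAddN (env x x x)). Qed.

HB.instance Definition _ := GRing.isZmodule.Build M addA addC add0 addN.

Let scaleA r r' (x : M) :
  alg_scale r (alg_scale r' x) = alg_scale (r * r') x :> carrier A.
Proof. exact: (lawA (LawScaleA r r') (env x x x)). Qed.

Let scale1 : left_id 1 (@alg_scale R F ar A : R -> M -> M).
Proof. by move=> x; apply: (lawA LawScale1 (env x x x)). Qed.

Let scaleDr :
  right_distributive (@alg_scale R F ar A : R -> M -> M) +%R.
Proof. by move=> r x y; apply: (lawA (LawScaleDr r) (env x y x)). Qed.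

Let scaleDl (x : M) :
  {morph (@alg_scale R F ar A : R -> M -> M)^~ x : r r' / r + r'}.
Proof. by move=> r r'; apply: (lawA (LawScaleDl r r') (env x x x)). Qed.

HB.instance Definition _ :=
  GRing.Zmodule_isLmodule.Build R M scaleA scale1 scaleDr scaleDl.

Let op_multilinear f :
  multilinear_on [set: 'I_(ar f)] (@alg_op R F ar A f : ('I_(ar f) -> M) -> M).
Proof.
move=> a j _ r u v.
(* The variable k + 2 takes the value a k for k < ar f; a value is needed for
   larger k, and u serves as the default. *)
pose e (n : nat) : carrier A := match n with
  | 0 => u | 1 => v | k.+2 => oapp a u (insub k : option 'I_(ar f)) end.
have := lawA (LawOp j r) e.
have evalE w x : eval e w = x ->
    alg_op A f (fun i => eval e (if i == j then w else Var R ar i.+2)) =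
    alg_op A f [eta a with j |-> x].
  move=> <-; congr alg_op; apply: funext => i /=.
  by case: eqP => // _; rewrite /= valK.
rewrite /= (evalE _ (r *: u + v : M)) // (evalE _ u) // (evalE _ v) //.
Qed.

Definition law_mexp : mexp R ar := Mexp op_multilinear.

End LawModule.

Lemma RMF_variety : variety (@RMF R F ar).
Proof.
exists law => A; split=> [[M ->] t s|lawA]; last first.
  by exists (law_mexp lawA); case: A lawA => *.
case=> [e|e|e|e|r r' e|e|r e|r r' e|f j r x e] /=.
- exact: addrA.
- exact: addrC.
- exact: add0r.
- exact: addNr.
- exact: scalerA.
- exact: scale1r.
- exact: scalerDr.
- exact: scalerDl.
- have evalE w : mexp_op M f
        (fun i => eval (A := alg_of M) e
                    (if i == j then w else Var R ar i.+2)) =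
      mexp_op M f
        [eta (fun i : 'I_(ar f) => e i.+2) with
           j |-> eval (A := alg_of M) e w].
    by congr mexp_op; apply: funext => i /=; case: eqP.
  by rewrite !evalE; apply: mexp_opP; rewrite inE.
Qed.

End Varieties.

(** * The lattice of varieties containing the datum *)

Section Lattice.
Variables (R : pzRingType) (F : Type) (ar : F -> nat) (Q I : mexp R ar).
Local Notation Lat := (varieties_containing Q I).

(** _R M_F is intersected in explicitly so that K may be empty. *)
Lemma varieties_containing_inter (K : class (class (alg R ar))) :
  subclass K Lat -> Lat (fun A => RMF A /\ forall U, K U -> U A).
Proof.
move=> KL; split.
- have [U|Sigma SigmaP] :=
    @variety_inter R F ar (fun U => U = @RMF R F ar \/ K U).
    by case=> [->|/KL[]//]; apply: RMF_variety.
  exists Sigma => A; rewrite -SigmaP.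
  split=> [[RA KA] U [->|]//|KA]; first exact: KA.
  by split=> [|U KU]; apply: KA; [left | right].
- by move=> A [].
- by split=> [|U /KL[]//]; exists Q.
- by split=> [|U /KL[]//]; exists I.
Qed.

Lemma varieties_containing_lattice : complete_lattice Lat.
Proof.
move=> S SL; split.
  (* The join is the intersection of the upper bounds in the lattice. *)
  pose K V := Lat V /\ forall U, S U -> subclass U V.
  exists (fun A => RMF A /\ forall V, K V -> V A); split.
  - by apply: varieties_containing_inter => V [].
  - move=> U SU A UA; split=> [|V [_ VS]]; last exact: VS SU _ UA.
    by have [_ UR _ _] := SL U SU; apply: UR.
  - by move=> V LV SV A [_ KA]; apply: KA.
exists (fun A => RMF A /\ forall U, S U -> U A); split.
- exact: varieties_containing_inter.
- by move=> U SU A [_]; apply.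
- move=> V [_ VR _ _] VS A VA; split=> [|U SU]; first exact: VR.
  exact: VS VA.
Qed.

End Lattice.

(** * Expansion of multilinear maps *)

Lemma multilinear_eq0 (R : pzRingType) n (s : {set 'I_n}) (A B : lmodType R)
    (g : ('I_n -> A) -> B) (a : 'I_n -> A) j :
  multilinear_on s g -> j \in s -> a j = 0 -> g a = 0.
Proof.
move=> g_lin js aj0; have /= gj := g_lin a j js.
have upd0 : ([eta a with j |-> 0] : 'I_n -> A) = a.
  by apply: funext => i /=; case: eqP => // ->.
(* Linearity at -1, 0, 0 reads g a = - g a + g a. *)
have := gj (-1) 0 0.
by rewrite scaler0 addr0 upd0 scaleN1r addNr.
Qed.

(** Multilinear form of the binomial expansion, at the argument that is b - h in
    the coordinates in d and h in the others. *)
Lemma multilinear_expand (R : pzRingType) n (s : {set 'I_n}) (A B : lmodType R)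
    (g : ('I_n -> A) -> B) (d : {set 'I_n}) (h b : 'I_n -> A) :
    multilinear_on s g -> d \subset s ->
  g (replace h d (fun j => b j - h j)) =
    \sum_(u : {set 'I_n} | u \subset d)
      (-1) ^+ #|d :\: u| *: g (replace h u b).
Proof.
move=> g_lin; have [m] := ubnP #|d|; elim: m d h => // m IH d h dm ds.
have [->|[i id]] := set_0Vmem d.
  rewrite (big_pred1 set0) => [|u]; last by rewrite subset0.
  rewrite setDv cards0 expr0 scale1r; congr g.
  by apply: funext => j; rewrite /replace inE.
have d'm : (#|d :\ i| < m)%N by move: dm; rewrite (cardsD1 i) id.
have d's : d :\ i \subset s by apply: subset_trans ds; apply: subD1set.
pose hi : 'I_n -> A := [eta h with i |-> b i].
rewrite (bigID [pred u : {set 'I_n} | i \in u]) /=.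
(* The coordinate i is split off: hi has the value b i there, so that the
   subsets of d containing i come from the expansion at hi. *)
have -> : g (replace h d (fun j => b j - h j)) =
    g (replace hi (d :\ i) (fun j => b j - hi j)) -
    g (replace h (d :\ i) (fun j => b j - h j)).
  have /= gi := g_lin (replace h d (fun j => b j - h j)) i (subsetP ds _ id).
  have := gi (-1) (h i) (b i); rewrite !scaleN1r [- _ + _]addrC => gE.
  transitivity (g [eta replace h d (fun j => b j - h j) with i |-> b i - h i]).
    by congr g; apply: funext => j /=; case: eqP => // ->; rewrite /replace id.
  rewrite gE addrC; congr (g _ - g _).
    apply: funext => j; rewrite /replace /hi /= !inE.
    by case: eqP => [->|].
  apply: funext => j; rewrite /replace /= !inE.
  by case: eqP => [->|].
congr (_ + _).
  rewrite IH // [RHS](reindex_onto (fun u => i |: u) (fun u => u :\ i)) /=;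
    last first.
    by move=> u /andP[_ iu]; rewrite setD1K.
  apply: eq_big => u.
    rewrite setU11 andbT subUset sub1set id /= subsetD1.
    case ui: (i \in u) => /=; last by rewrite setU1K ?ui // eqxx.
    by rewrite andbF; apply/esym/negbTE/negP => /andP[_ /eqP/setP/(_ i)];
      rewrite !inE eqxx ui.
  move=> ud; rewrite setDDl; congr (_ *: g _); apply: funext => j.
  by rewrite /replace /hi /= !inE; case: eqP => //= ->; case: ifP.
rewrite IH // -sumrN; apply: eq_big => u; first by rewrite subsetD1.
move=> /[!subsetD1] /andP[ud iu].
have -> : d :\: u = i |: ((d :\ i) :\: u).
  apply/setP => j; rewrite !inE; case: eqP => // ->.
  by rewrite id iu.
by rewrite cardsU1 !inE eqxx /= andbF add1n exprS mulN1r scaleNr.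
Qed.

(** A sum over all subsets, with the two improper ones split off; the index set
    has to be nonempty for these to be distinct. *)
Lemma sum_pset (V : zmodType) n (P : pred {set 'I_n}) (G : {set 'I_n} -> V) :
    (0 < n)%N ->
  \sum_(u | P u) G u =
    (if P [set: 'I_n] then G [set: 'I_n] else 0)
    + (if P set0 then G set0 else 0)
    + \sum_(s : pset n | P (val s)) G (val s).
Proof.
move=> n_gt0; have neq0T : (set0 == [set: 'I_n]) = false.
  by apply/negbTE/negP => /eqP/setP/(_ (Ordinal n_gt0)); rewrite !inE.
rewrite !(big_mkcond P) (bigD1 [set: 'I_n]) //= (bigD1 set0) ?neq0T //= addrA.
congr (_ + _); rewrite (eq_bigl (mem [pred u | (u != set0) && (u != setT)])).
  rewrite (big_sub [pred u | (u != set0) && (u != setT)]).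
  by rewrite [RHS]big_mkcond.
by move=> u; rewrite andbC.
Qed.

(** * Extensions by 2-cocycles *)

Section Extensions.
Variables (R : pzRingType) (F : Type) (ar : F -> nat).
Hypothesis ar_gt0 : forall f : F, (0 < ar f)%N.
Variables (Q I : mexp R ar).
Implicit Types (T : cocycle Q I) (t s : term R ar) (U V : class (alg R ar)).
Local Notation Lat := (varieties_containing Q I).

Lemma snd_hom T : hom (A := semidirect T) (B := alg_of Q) snd.
Proof. by []. Qed.

Lemma semidirect_quotient T t s :
  satisfies (semidirect T) t s -> satisfies (alg_of Q) t s.
Proof.
have sndK : cancel (fun x : Q => (0 : I, x)) snd by [].
exact: (satisfies_quotient (snd_hom T) sndK).
Qed.

(** For an identity of both Q and I, holding in the extension by T amounts to
    the equality of the defects. *)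
Lemma satisfies_semidirect T t s :
    satisfies (alg_of Q) t s -> satisfies (alg_of I) t s ->
  satisfies (semidirect T) t s <-> forall a q, defect T t a q = defect T s a q.
Proof.
move=> Qts Its; split=> [Tts a q|Dts e]; first by rewrite /defect Tts Its.
have -> : e = fun i => ((e i).1, (e i).2) by apply: funext => i; case: (e i).
apply: injective_projections; last first.
  by rewrite !(hom_eval (snd_hom T)) Qts.
by have := Dts (fun i => (e i).1) (fun i => (e i).2);
  rewrite /defect Its => /addIr.
Qed.

Lemma compatible_semidirect U T : Lat U -> compatible U T <-> U (semidirect T).
Proof.
move=> [vU _ UQ UI]; split=> [cT|UT t s Uts].
  apply/(varietyP vU) => t s Uts; apply/satisfies_semidirect; try exact: Uts.
  exact: cT.
by apply/satisfies_semidirect; apply: Uts.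
Qed.

(** The 2-cocycle with zero factor sets and zero action terms; its extension is
    the direct product of I and Q. *)
Definition zero_cocycle : cocycle Q I.
Proof.
apply: (@Cocycle R F ar Q I (fun _ _ => 0) (fun _ _ => 0) (fun _ _ => 0)
  (fun _ _ _ _ => 0)) => //.
by move=> f s q a j _ r u v /=; rewrite scaler0 addr0.
Defined.

Lemma fst_hom : hom (A := semidirect zero_cocycle) (B := alg_of I) fst.
Proof.
split=> //= [x y|x|r x|f x]; rewrite ?addr0 ?subr0 //.
by rewrite big1 ?addr0.
Qed.

Lemma zero_cocycle_compatible U : Lat U -> compatible U zero_cocycle.
Proof.
move=> [_ _ _ UI] t s Uts a q.
by rewrite /defect !(hom_eval fst_hom) /= !subrr.
Qed.

(** The witness is h = 0: every term on the right-hand sides of the conditions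
    of equivalence has a zero argument, which for f itself at the empty set
    requires the arity to be positive. *)
Lemma equivalent_refl T : equivalent T T.
Proof.
exists (fun _ => 0) => //; split=> [x y|r x|f x|f s x a]; rewrite subrr.
- by rewrite addr0 subr0.
- by rewrite scaler0 subr0.
- rewrite (multilinear_eq0 (@mexp_opP _ _ _ I f)
    (in_setT (Ordinal (ar_gt0 f)))) //.
  rewrite scaler0 subr0 addr0 big1 // => s _.
  have /andP[/set0Pn[j js] _] := valP s.
  by rewrite (multilinear_eq0 (@act_multilinear _ _ _ _ _ T f s x) js) ?scaler0.
- have /andP[_ sT] := valP s.
  have /properP[_ [i _ is_]] : val s \proper [set: 'I_(ar f)].
    by rewrite properEneq sT subsetT.
  rewrite (multilinear_eq0 (@mexp_opP _ _ _ I f) (in_setT i)); last first.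
    by rewrite /replace (negbTE is_).
  rewrite scaler0 addr0 big1 // => r /properP[_ [j jr js]].
  rewrite (multilinear_eq0 (@act_multilinear _ _ _ _ _ T f r x) jr) ?scaler0 //.
  by rewrite /replace (negbTE js).
Qed.

(** The translation by - h, from the extension by T' to that by T. *)
Definition twist (h : Q -> I) (u : I * Q) : I * Q := (u.1 - h u.2, u.2).

Lemma twistK (h : Q -> I) : cancel (fun u => (u.1 + h u.2, u.2)) (twist h).
Proof. by case=> a x; rewrite /twist /= addrK. Qed.

Lemma act_expand T f (r : pset (ar f)) (x : 'I_(ar f) -> Q)
    (h b : 'I_(ar f) -> I) :
  act T f r x (fun j => b j - h j) =
    (-1) ^+ #|val r| *: act T f r x h + act T f r x b +
    \sum_(s : pset (ar f) | val s \proper val r)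
      (-1) ^+ (#|val r| - #|val s|) *: act T f r x (replace h (val s) b).
Proof.
have actE a a' : (forall j, j \in val r -> a j = a' j) ->
    act T f r x a = act T f r x a' by move=> aa'; apply: act_dep.
rewrite (actE _ (replace h (val r) (fun j => b j - h j))); last first.
  by move=> j jr; rewrite /replace jr.
rewrite (multilinear_expand _ _ (@act_multilinear _ _ _ _ _ T f r x)) //.
rewrite (sum_pset (fun u => u \subset val r)) // sub0set subTset.
have /andP[_ /negbTE rT] := valP r; rewrite rT add0r setD0.
rewrite (actE (replace h set0 b) h); last by move=> j _; rewrite /replace inE.
rewrite (bigD1 r) //= setDv cards0 expr0 scale1r -addrA.
rewrite (actE (replace h (val r) b) b); last first.
  by move=> j jr; rewrite /replace jr.
congr (_ + (_ + _)); apply: eq_big => s.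
  by rewrite properEneq andbC (inj_eq val_inj).
by case/andP=> sr _; rewrite cardsD (setIidPr sr).
Qed.

Lemma op_expand f (h b : 'I_(ar f) -> I) :
  mexp_op I f (fun j => b j - h j) =
    (-1) ^+ ar f *: mexp_op I f h + mexp_op I f b +
    \sum_(s : pset (ar f))
      (-1) ^+ (ar f - #|val s|) *: mexp_op I f (replace h (val s) b).
Proof.
have replaceT a : replace h [set: 'I_(ar f)] a = a.
  by apply: funext => j; rewrite /replace inE.
have replace0 a : replace h set0 a = h.
  by apply: funext => j; rewrite /replace inE.
rewrite -[in LHS](replaceT (fun j => b j - h j)).
rewrite (multilinear_expand _ _ (@mexp_opP _ _ _ I f)) //.
rewrite (sum_pset (fun u => u \subset [set: 'I_(ar f)])) // !subsetT.
rewrite setDv cards0 expr0 scale1r setD0 cardsT card_ord replaceT replace0.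
rewrite [_ + mexp_op I f b]addrC; congr (_ + _ + _).
apply: eq_big => [s|s _]; first by rewrite subsetT.
by rewrite cardsD setTI cardsT card_ord.
Qed.

Let signS k m (v : I) : (k <= m)%N ->
  (-1) ^+ (1 + m - k) *: v = - ((-1) ^+ (m - k) *: v).
Proof. by move=> km; rewrite -addnBA // exprS mulN1r scaleNr. Qed.

(** The signs in the definition of equivalence are those of the expansions of
    a(f,r) and f at b - h: the terms at the empty set give the condition on T_f,
    the terms at a nonempty proper s that on a(f,s), and the remaining term is
    f(b). *)
Lemma equivalent_twist_hom T T' : equivalent T T' ->
  exists h, hom (A := semidirect T') (B := semidirect T) (twist h).
Proof.
move=> [h h0 [TD TZ Top Tact]]; exists h.
split=> /= [[a x] [b y]|[a x]||r [a x]|f u];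
  rewrite /twist /=; congr (_, _).
- have /eqP := TD x y; rewrite subr_eq => /eqP->.
  rewrite [a - _ + _]addrACA -opprD -[h x + h y - _ + _]addrA [RHS]addrA subrK.
  by rewrite [- _ + _]addrC addrA.
- have /eqP := TD x (- x); rewrite subr_eq subrr h0 subr0 => /eqP->.
  by rewrite !opprD opprK !addrA addrK addrAC.
- by rewrite h0 subr0.
- have /eqP := TZ r x; rewrite subr_eq => /eqP->.
  rewrite scalerBr -[r *: h x - _ + _]addrA [RHS]addrA subrK.
  by rewrite [- _ + _]addrC addrA.
set b := fun i => (u i).1; set x := fun i => (u i).2.
rewrite (op_expand (h \o x) b).
have -> : co_op T f x =
    - (\sum_(r : pset (ar f)) (-1) ^+ #|val r| *: act T f r x (h \o x)
       + (-1) ^+ ar f *: mexp_op I f (h \o x))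
    - h (mexp_op Q f x) + co_op T' f x.
  have /eqP := Top f x; rewrite subr_eq => /eqP->; congr (_ - _ + _).
  rewrite opprD -sumrN add1n exprS mulN1r scaleNr; congr (_ - _).
  by apply: eq_bigr => r _; rewrite add1n exprS mulN1r scaleNr.
(* The terms at s strictly inside r occur in the expansion of a(f,r) and in the
   condition on a(f,s); the two double sums differ by the order of summation. *)
pose cross (s r : pset (ar f)) := (-1) ^+ (#|val r| - #|val s|) *:
  act T f r x (replace (h \o x) (val s) b).
have -> : \sum_(r : pset (ar f)) act T f r x (fun i => b i - h (x i)) =
    \sum_(r : pset (ar f)) (-1) ^+ #|val r| *: act T f r x (h \o x) +
    \sum_(r : pset (ar f)) act T f r x b +
    \sum_(r : pset (ar f)) \sum_(s : pset (ar f) | val s \proper val r)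
      cross s r.
  by rewrite -!big_split; apply: eq_bigr => r _;
    rewrite (act_expand _ _ _ (h \o x)).
have -> : \sum_(s : pset (ar f)) act T' f s x b =
    \sum_(s : pset (ar f)) act T f s x b +
    \sum_(r : pset (ar f)) \sum_(s : pset (ar f) | val s \proper val r)
      cross s r +
    \sum_(s : pset (ar f)) (-1) ^+ (ar f - #|val s|) *:
      mexp_op I f (replace (h \o x) (val s) b).
  rewrite (exchange_big_dep xpredT) //= -!big_split; apply: eq_bigr => s _ /=.
  have s_le : (#|val s| <= ar f)%N by rewrite -[leqRHS]card_ord max_card.
  rewrite -[act T' f s x b](subKr (act T f s x b)) Tact.
  rewrite signS // opprD opprK -sumrN addrA; congr (_ + _ + _).
  apply: eq_bigr => r /proper_card/ltnW sr.
  by rewrite signS // opprK.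
set D := \sum_r _ *: _; set B := \sum_r act T f r x b.
set C := \sum_r \sum_(s | _) _; set E := \sum_s _ *: _; set G := _ *: _.
rewrite [G + _ + D + _](AC (3*3) ((2*(5*6*3))*(4*1))) /=.
by rewrite -[- _ - _ + _]addrA [RHS]addrA addrK [- _ + _]addrC [RHS]addrA.
Qed.

Lemma equivalent_satisfies T T' t s : equivalent T T' ->
  satisfies (semidirect T') t s -> satisfies (semidirect T) t s.
Proof.
move=> /equivalent_twist_hom[h h_hom].
exact: (satisfies_quotient h_hom (twistK h)).
Qed.

Lemma H2_semidirect U T : Lat U -> H2 Q I U (eqclass T) <-> U (semidirect T).
Proof.
move=> LU; split=> [[T' cT' TT']|UT]; last first.
  by exists T => //; apply/(compatible_semidirect _ LU).
have /(compatible_semidirect _ LU) UT' := cT'.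
(* By reflexivity T' is in its own class, which is also that of T. *)
have eqTT' : equivalent T T'.
  by rewrite -/(eqclass T T') TT'; apply: equivalent_refl.
have [vU _ _ _] := LU; apply/(varietyP vU) => t s Uts.
exact: equivalent_satisfies eqTT' (Uts _ UT').
Qed.

End Extensions.

(** * The Galois connection *)

Theorem proposition3p25 (R : pzRingType) (F : Type) (ar : F -> nat)
    (ar_gt0 : forall f : F, (0 < ar f)%N) (Q I : mexp R ar) :
  let Lat := varieties_containing Q I in
  let Coh := H2s Q I in
  let Psi := H2 Q I in
  let Theta := Theta Q I in
  complete_lattice Lat /\
  [/\ forall U, Lat U -> Coh (Psi U),
      forall E, Coh E -> Lat (Theta E),
      forall U V, Lat U -> Lat V -> subclass U V -> subclass (Psi U) (Psi V),
      forall E E', Coh E -> Coh E' ->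
        subclass E E' -> subclass (Theta E) (Theta E')
    & forall E U, Coh E -> Lat U ->
        (subclass (Theta E) U <-> subclass E (Psi U))].
Proof.
move=> Lat Coh Psi Theta; split; first exact: varieties_containing_lattice.
have gen E T : E (eqclass T) -> Theta E (semidirect T).
  by move=> ET U _; apply; exists T.
have adj E U : Coh E -> Lat U -> subclass (Theta E) U <-> subclass E (Psi U).
  move=> [V LV ->] LU; split=> [VU c [T cT ->]|VU A ThA].
    by apply/(H2_semidirect ar_gt0 _ LU); apply: VU; apply: gen; exists T.
  have [vU _ _ _] := LU; apply: ThA => // _ [T VT ->].
  exact/(H2_semidirect ar_gt0 _ LU)/VU.
split=> //.
- by move=> U LU; exists U.
- move=> E CohE; have [V LV EV] := CohE.
  have ThV : subclass (Theta E) V by apply/adj => //; rewrite EV.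
  have vTh : variety (Theta E) by apply: generated_variety_variety.
  have Th0 : Theta E (semidirect (zero_cocycle Q I)).
    apply: gen; rewrite EV; apply/(H2_semidirect ar_gt0 _ LV).
    exact/(compatible_semidirect _ LV)/(zero_cocycle_compatible LV).
  split=> //; first by have [_ VR _ _] := LV => A /ThV/VR.
    apply/(varietyP vTh) => t s /(_ _ Th0); exact: semidirect_quotient.
  apply/(varietyP vTh) => t s /(_ _ Th0).
  have fstK : cancel (fun a : I => (a, 0 : Q)) fst by [].
  exact: (satisfies_quotient (fst_hom Q I) fstK).
- move=> U V _ _ UV _ [T cT ->]; exists T => // t s Vts; apply: cT => A /UV.
  exact: Vts.
- move=> E E' _ _ EE' A ThA U vU E'U; apply: ThA => // _ [T ET ->].
  by apply: E'U; exists T => //; apply: EE'.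
Qed.
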